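(* The ring $\mathcal{R}=\frac{GR(p^a,m)[x]}{\langle f(x)\rangle}$ is a chain ring if and only if at least one of the following conditions holds: (1) $a=1$; (2) $t=1$; (3) $\beta(x)\notin\langle p,h(x)\rangle$ (ideal of $GR(p^a,m)[x]$).
   Context: A commutative ring is a chain ring if its ideals are linearly ordered under inclusion. $p$ is a prime, $a,m\ge 1$; $GR(p^a,m)$ is the Galois ring of characteristic $p^a$ with $p^{am}$ elements, a local ring with maximal ideal $\langle p\rangle$ and residue field $\mathbb{F}_{p^m}$. A bar denotes reduction modulo $p$ (applied coefficientwise to polynomials). $\mathcal{T}_m=\{0,1,\zeta,\dots,\zeta^{p^m-2}\}\subset GR(p^a,m)$ is the Teichmüller set ($\zeta$ of multiplicative order $p^m-1$), identified with $\mathbb{F}_{p^m}$. A polynomial in $GR(p^a,m)[x]$ is regular if it is not a zero divisor (equivalently some coefficient is a unit), primary if it generates a primary ideal, and basic irreducible if it is irreducible and its reduction modulo $p$ is irreducible. Standing assumption: $f(x)\in GR(p^a,m)[x]$ is a monic regular primary polynomial which is not a unit, written as $f(x)=h(x)^t+p\beta(x)$ with $t\ge 1$, $h(x)$ a monic basic irreducible polynomial with $\overline{h}(x)=h(x)$ (i.e. the coefficients of $h$ lie in $\mathcal{T}_m$), $\beta(x)\in GR(p^a,m)[x]$ and $\deg\beta(x)<t\deg h(x)$. *)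

(* Defs.v *)
From HB Require Import structures.
From mathcomp Require Import all_boot all_order all_algebra.

Set Implicit Arguments.
Unset Strict Implicit.
Unset Printing Implicit Defensive.

Import GRing.Theory.
Local Open Scope ring_scope.

Section Ideals.
Variable A : comNzRingType.
Implicit Types (I J : A -> Prop) (x y a b : A).

(* The unit ideal is allowed, unlike in [idealr_closed]. *)
Definition is_ideal I : Prop :=
  [/\ I 0, forall x y, I x -> I y -> I (x + y) & forall a x, I x -> I (a * x)].

Definition subideal I J : Prop := forall x, I x -> J x.

Definition chain_ring : Prop :=
  forall I J, is_ideal I -> is_ideal J -> subideal I J \/ subideal J I.

Definition ideal1 a : A -> Prop := fun x => exists u, x = u * a.

Definition ideal2 a b : A -> Prop := fun x => exists u v, x = u * a + v * b.

Definition proper_ideal_of I : Prop := is_ideal I /\ ~ I 1.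

Definition maximal_ideal_of I : Prop :=
  proper_ideal_of I /\ forall J, proper_ideal_of J -> subideal I J -> subideal J I.

Definition local_with_maximal_ideal I : Prop :=
  maximal_ideal_of I /\ forall J, maximal_ideal_of J -> forall x, J x <-> I x.

Definition primary_ideal I : Prop :=
  proper_ideal_of I /\ forall x y, I (x * y) -> I x \/ exists n : nat, I (y ^+ n).

(* [{poly R}] has a unit predicate only for an integral domain [R]. *)
Definition is_unit x : Prop := exists y, x * y = 1.

Definition irreducible_elt x : Prop :=
  ~ is_unit x /\ forall a b, x = a * b -> is_unit a \/ is_unit b.

End Ideals.

(* Up to isomorphism, GR(p^a, m) is the only ring satisfying this. The library's
   [pchar] only knows prime characteristics, so the characteristic is given by
   the vanishing of the integer multiples of 1. *)
Definition is_galois_ring (p a m : nat) (R : finComNzRingType) : Prop :=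
  [/\ forall n : nat, n%:R = 0 :> R <-> (p ^ a %| n)%N,
      #|R| = (p ^ (a * m))%N
    & local_with_maximal_ideal (ideal1 (p%:R : R))].

(* [red] presents [F] as the residue field of [R] modulo [p]. *)
Definition is_reduction_mod (p : nat) (R : finComNzRingType) (F : finFieldType)
    (red : {rmorphism R -> F}) : Prop :=
  (forall y : F, exists x : R, red x = y) /\
  (forall x : R, red x = 0 <-> ideal1 (p%:R : R) x).

Definition teichmuller (p m : nat) (R : finComNzRingType) (zeta : R) : {set R} :=
  0 |: [set zeta ^+ i | i : 'I_(p ^ m).-1].

Definition basic_irreducible (R : finComNzRingType) (F : finFieldType)
    (red : {rmorphism R -> F}) (h : {poly R}) : Prop :=
  irreducible_elt h /\ irreducible_poly (map_poly red h).

(* Main.v *)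
Require Import Defs.
From HB Require Import structures.
From mathcomp Require Import all_boot all_order all_algebra.
From mathcomp Require Import ring.
From Stdlib Require Import Classical.

Set Implicit Arguments.
Unset Strict Implicit.
Unset Printing Implicit Defensive.

Import GRing.Theory.
Local Open Scope ring_scope.

(** Both [p] and the class of [h] are nilpotent in the quotient
    [Q = R[x]/<f>], the latter because [h ^+ t = - p beta] there, and every
    element of [R[x]] is either in [<p, h>] or invertible modulo [<p, h>],
    since the reduction of [h] is irreducible.  So [Q] is local with maximal
    ideal [<p, h>], and the question is whether this ideal is principal.

    If one nilpotent element [w] generates the maximal ideal, every element of
    [Q] is a unit times a power of [w], so divisibility is total, which is the
    same as being a chain ring ([chain_ring_total_dvd] and
    [chain_ring_nilpotent_generator]).  Each of the three conditions makes one
    generator redundant ([chain_ring_nilpotent_pair]): if [a = 1] then [p = 0];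
    if [t = 1] then [h = - p beta]; and if [beta] is not in [<p, h>] it is a
    unit of [Q], so that [p] is a multiple of [h ^+ t].

    Conversely, in a chain ring [p] and [h] are comparable.  If [p] divides [h]
    in [Q], reducing modulo [p] shows that [hbar ^+ t] divides [hbar], whence
    [t = 1].  If [h] divides [p] in [Q] while [beta] lies in [<p, h>], the
    equation [p = u h + v f] can be rearranged, by inverting an element
    [1 + p s], into [p] being a multiple of [h] already in [R[x]].  As [h] is
    monic of positive degree, this forces [p = 0], that is [a = 1]. *)

(** * Chain rings and nilpotent elements *)

Section ChainRings.
Variable A : comNzRingType.
Implicit Types p h b w x y : A.

Lemma ideal1_is_ideal x : is_ideal (ideal1 x).
Proof.
split=> [|y z [u ->] [v ->]|y z [u ->]]; first by exists 0; rewrite mul0r.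
  by exists (u + v); rewrite mulrDl.
by exists (y * u); rewrite mulrA.
Qed.

(** Comparing principal ideals suffices: if [x] lies in [I] but not in [J], then
    [x] divides every [y] in [J], as [y] cannot divide [x].  Excluded middle
    enters because membership in an ideal is an arbitrary proposition. *)
Lemma chain_ring_total_dvd :
  chain_ring A <-> forall x y, ideal1 x y \/ ideal1 y x.
Proof.
split=> [chainA x y | total I J [_ _ mulI] [_ _ mulJ]].
  have refl z : ideal1 z z by exists 1; rewrite mul1r.
  case: (chainA _ _ (ideal1_is_ideal x) (ideal1_is_ideal y)) => sub.
    by right; apply: sub.
  by left; apply: sub.
case: (classic (subideal I J)) => [|notIJ]; [by left | right=> y Jy].
apply: NNPP => notIy; apply: notIJ => x Ix; case: (total x y) => -[u Du].
  by case: notIy; rewrite Du; apply: mulI.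
by rewrite Du; apply: mulJ.
Qed.

Lemma is_unit1_add_nilpotent x n : x ^+ n = 0 -> is_unit (1 + x).
Proof.
move=> xn0; exists (\sum_(i < n) (- x) ^+ i).
have := subrX1 (- x) n; rewrite exprNn xn0 mulr0 => E.
by rewrite -[RHS]opprK -(sub0r 1) E; ring.
Qed.

Lemma is_unitMr x u : is_unit (u * x) -> is_unit x.
Proof. by case=> v E; exists (u * v); rewrite -E; ring. Qed.

Lemma is_unit1_add_multiple w n x :
  w ^+ n = 0 -> ideal1 w (x - 1) -> is_unit x.
Proof.
move=> wn0 [u Dx]; rewrite -[x](subrK 1) addrC Dx.
by apply: (@is_unit1_add_nilpotent _ n); rewrite exprMn wn0 mulr0.
Qed.

(** An element outside [<w>] is a unit, because it is one modulo the nilpotent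
    [w].  Dividing by [w] as often as possible therefore writes every element as
    a unit times a power of [w], and divisibility compares the exponents. *)
Lemma chain_ring_nilpotent_generator w n :
    w ^+ n = 0 ->
    (forall x, ideal1 w x \/ exists u, ideal1 w (u * x - 1)) ->
  chain_ring A.
Proof.
move=> wn0 dich.
(* Keep dividing by [w]: at exponent [n] only [0 = 1 * w ^+ n] remains. *)
have factor k x : (exists v i, is_unit v /\ x = v * w ^+ i) \/
                  exists v, x = v * w ^+ k.
  elim: k => [|k [|[v ->]]]; [by right; exists x; rewrite mulr1 | by left |].
  case: (dich v) => [[u ->]|[u uv1]].
    by right; exists u; rewrite exprS mulrA.
  left; exists v, k; split=> //.
  exact: is_unitMr (is_unit1_add_multiple wn0 uv1).
have {factor} unit_power x : exists v i, is_unit v /\ x = v * w ^+ i.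
  case: (factor n x) => // -[v ->]; exists 1, n; split; last by rewrite wn0 !mulr0.
  by exists 1; rewrite mulr1.
have dvd v1 v2 i j : is_unit v1 -> (i <= j)%N ->
    ideal1 (v1 * w ^+ i) (v2 * w ^+ j).
  move=> [v1' v1K] le_ij; exists (v2 * v1' * w ^+ (j - i)).
  rewrite -{1}(subnK le_ij) exprD -{1}[v2]mulr1 -v1K; ring.
apply/chain_ring_total_dvd => x y.
have [v1 [i [Uv1 ->]]] := unit_power x; have [v2 [j [Uv2 ->]]] := unit_power y.
by case/orP: (leq_total i j) => le; [left | right]; apply: dvd.
Qed.

(** The relation is that of [f] in the quotient.  It makes [h] nilpotent along
    with [p], and in each of the three cases it makes one of [p] and [h] a
    multiple of the other. *)
Lemma chain_ring_nilpotent_pair p h b a t :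
    p ^+ a = 0 -> h ^+ t + p * b = 0 -> (0 < t)%N ->
    (forall x, ideal2 p h x \/ exists u, ideal2 p h (u * x - 1)) ->
    [\/ p = 0, t = 1%N | exists u, ideal2 p h (u * b - 1)] ->
  chain_ring A.
Proof.
move=> pa0 rel t_gt0 dich cond.
have ht : h ^+ t = - b * p by rewrite -[LHS](addrK (p * b)) rel; ring.
have hta0 : h ^+ (t * a) = 0 by rewrite exprM ht exprMn pa0 mulr0.
have of_p : ideal1 p h -> chain_ring A.
  case=> c Dh; apply: (chain_ring_nilpotent_generator pa0) => x.
  case: (dich x) => [[u [v ->]]|[y [u [v Dy]]]].
    by left; exists (u + v * c); rewrite {}Dh; ring.
  by right; exists y, (u + v * c); rewrite Dy {}Dh; ring.
have of_h : ideal1 h p -> chain_ring A.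
  case=> c Dp; apply: (chain_ring_nilpotent_generator hta0) => x.
  case: (dich x) => [[u [v ->]]|[y [u [v Dy]]]].
    by left; exists (u * c + v); rewrite {}Dp; ring.
  by right; exists y, (u * c + v); rewrite Dy {}Dp; ring.
case: cond => [p0 | t1 | [u [c [d Du]]]].
- by apply: of_h; exists 0; rewrite mul0r.
- by apply: of_p; exists (- b); rewrite -ht t1.
apply: of_h; have [e De] : is_unit (1 + c * p).
  by apply: (@is_unit1_add_nilpotent _ a); rewrite exprMn pa0 mulr0.
(* Multiply [u b = 1 + c p + d h] by [p] and use [b p = - h ^+ t]. *)
have step : p * (1 + c * p) = - (u * h ^+ t.-1 + d * p) * h.
  have -> : p * (1 + c * p) = p * (u * b) - p * d * h.
    by rewrite -[u * b](subrK 1) Du; ring.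
  have -> : p * (u * b) = - u * (- b * p) by ring.
  by rewrite -ht -{1}(prednK t_gt0) exprS; ring.
exists (- (u * h ^+ t.-1 + d * p) * e).
by rewrite -[LHS]mulr1 -De mulrA step; ring.
Qed.

(** This lifts a divisibility by [h] from the quotient to [R[x]].  Substituting
    [b = c p + d h] into [p = u h + v (h ^+ t + p b)] makes [p (1 - v c p)] a
    multiple of [h], and [1 - v c p] is invertible since [p] is nilpotent. *)
Lemma dvd_nilpotent_of_dvd_mod p h b a t :
    p ^+ a = 0 -> (0 < t)%N -> ideal2 p h b ->
    ideal2 h (h ^+ t + p * b) p ->
  ideal1 h p.
Proof.
move=> pa0 t_gt0 [c [d Db]] [u [v Dp]].
have [e De] : is_unit (1 + - (v * c) * p).
  by apply: (@is_unit1_add_nilpotent _ a); rewrite exprMn pa0 mulr0.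
exists ((u + v * h ^+ t.-1 + v * d * p) * e).
rewrite -[LHS]mulr1 -De [LHS]mulrA.
suff -> : p * (1 + - (v * c) * p) = (u + v * h ^+ t.-1 + v * d * p) * h by ring.
rewrite mulrDr mulr1 {1}Dp Db -{1}(prednK t_gt0) exprS; ring.
Qed.

End ChainRings.

Lemma ideal2_morph (A B : comNzRingType) (phi : {rmorphism A -> B}) a b x :
  ideal2 a b x -> ideal2 (phi a) (phi b) (phi x).
Proof. by case=> u [v ->]; exists (phi u), (phi v); rewrite rmorphD !rmorphM. Qed.

Lemma ideal2_unit_morph (A B : comNzRingType) (phi : {rmorphism A -> B}) a b x :
    (exists u, ideal2 a b (u * x - 1)) ->
  exists u, ideal2 (phi a) (phi b) (u * phi x - 1).
Proof.
case=> u /(ideal2_morph phi); rewrite rmorphB rmorphM rmorph1.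
by exists (phi u).
Qed.

(** This carries the sufficient conditions from [R[x]] over to its quotient:
    the relation [phi f = 0] and invertibility modulo [<c, h>] both pass to the
    image of a surjective morphism. *)
Lemma chain_ring_image_nilpotent_pair (A B : comNzRingType)
    (phi : {rmorphism A -> B}) c h b f a t :
    (forall y, exists x, y = phi x) -> phi f = 0 ->
    c ^+ a = 0 -> f = h ^+ t + c * b -> (0 < t)%N ->
    (forall x, ideal2 c h x \/ exists u, ideal2 c h (u * x - 1)) ->
    [\/ c = 0, t = 1%N | ~ ideal2 c h b] ->
  chain_ring B.
Proof.
move=> surj phif0 ca0 Df t_gt0 dich cond.
apply: (@chain_ring_nilpotent_pair _ (phi c) (phi h) (phi b) a t) => //.
- by rewrite -rmorphXn ca0 rmorph0.
- by rewrite -rmorphXn -rmorphM -rmorphD -Df.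
- move=> y; have [x ->] := surj y.
  case: (dich x) => [/(ideal2_morph phi) | ]; first by left.
  by move/(ideal2_unit_morph phi); right.
case: cond => [-> | t1 | b_notin]; [apply: Or31 | exact: Or32 | apply: Or33].
  by rewrite rmorph0.
by case: (dich b) => // /(ideal2_unit_morph phi).
Qed.

(** * Polynomial quotients *)

Section Quotient.
Variables (R : comNzRingType) (f : {poly R}).
Hypotheses (f_monic : f \is monic) (f_gt1 : (1 < size f)%N).

Lemma in_qpoly_eq0 q : in_qpoly f q = 0 <-> ideal1 f q.
Proof.
have mkf : mk_monic f = f by rewrite /mk_monic f_gt1 f_monic.
split=> [/(congr1 val) /= | [u ->]].
  by rewrite mkf => r0; exists (Pdiv.CommonRing.rdivp q f);
    rewrite {1}(Pdiv.RingMonic.rdivp_eq f_monic q) r0 addr0.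
by apply: val_inj; rewrite /= mkf Pdiv.RingMonic.rmodp_mull.
Qed.

Lemma in_qpoly_surj (x : {poly %/ f}) : exists q, x = in_qpoly f q.
Proof.
by exists (val x); apply: val_inj; rewrite [RHS]in_qpoly_small // size_mk_monic.
Qed.

Lemma ideal1_in_qpoly x y :
  ideal1 (in_qpoly f x) (in_qpoly f y) -> ideal2 x f y.
Proof.
case=> u Du; have [q Dq] := in_qpoly_surj u.
have [|v Dv] := (in_qpoly_eq0 (y - q * x)).1.
  by rewrite rmorphB rmorphM /= -Dq -Du subrr.
by exists q, v; rewrite -Dv addrC subrK.
Qed.

End Quotient.

Lemma monic_size1_is_unit (R : comNzRingType) (f : {poly R}) :
  f \is monic -> (size f <= 1)%N -> is_unit f.
Proof.
move=> f_monic /size1_polyC Df; exists 1; rewrite mulr1.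
by move: f_monic; rewrite Df monicE lead_coefC => /eqP ->.
Qed.

Lemma polyC_monic_multiple (R : comNzRingType) (h : {poly R}) c :
  h \is monic -> (1 < size h)%N -> ideal1 h c%:P -> c = 0.
Proof.
move=> h_monic h_gt1 [u Du]; have [u0|u_neq0] := eqVneq u 0.
  by apply/eqP; rewrite -polyC_eq0 Du u0 mul0r.
have := size_polyC_leq1 c; rewrite Du size_Mmonic //.
rewrite -size_poly_gt0 in u_neq0.
case: (size u) u_neq0 => // k _; case: (size h) h_gt1 => [|[|l]] // _.
by rewrite !addnS.
Qed.

(** * Reduction of polynomials *)

Section Reduction.
Variables (R : comNzRingType) (F : fieldType) (red : {rmorphism R -> F}).
Variable c : R.
Hypothesis red_surj : forall y, exists x, red x = y.
Hypothesis red_eq0 : forall x, red x = 0 <-> ideal1 c x.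

Lemma map_poly_surj (q : {poly F}) : exists r, map_poly red r = q.
Proof.
elim/poly_ind: q => [|q y [r Dr]]; first by exists 0; rewrite rmorph0.
have [x Dx] := red_surj y; exists (r * 'X + x%:P).
by rewrite rmorphD rmorphM /= map_polyX map_polyC Dr /= Dx.
Qed.

Lemma map_poly_eq0_ideal (q : {poly R}) :
  map_poly red q = 0 -> ideal1 c%:P q.
Proof.
elim/poly_ind: q => [|q y IHq]; first by exists 0; rewrite mul0r.
rewrite rmorphD rmorphM /= map_polyX map_polyC => /polyP E.
have [u Dy] : ideal1 c y.
  apply/red_eq0; have := E 0%N.
  by rewrite coefD coefMX coefC coef0 /= add0r.
have [|r Dr] := IHq.
  apply/polyP => i; have := E i.+1.
  by rewrite coefD coefMX coefC coef0 /= addr0 coef0.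
by exists (r * 'X + u%:P); rewrite Dr Dy polyCM; ring.
Qed.

(** Since [map_poly red h] is irreducible over a field, it either divides
    [map_poly red q] or admits a Bezout relation with it; both relations lift to
    [R] up to a multiple of [c]. *)
Lemma reduction_dichotomy (h q : {poly R}) :
    irreducible_poly (map_poly red h) ->
  ideal2 c%:P h q \/ exists u, ideal2 c%:P h (u * q - 1).
Proof.
move=> irr_h; have := irreducible_poly_coprime (map_poly red q) irr_h.
case: (boolP (map_poly red h %| map_poly red q)) => [/dvdpP[s Dq] _ | _].
  have [r Dr] := map_poly_surj s.
  have [|v Dv] := @map_poly_eq0_ideal (q - r * h).
    by rewrite rmorphB rmorphM /= Dr Dq subrr.
  by left; exists v, r; rewrite -Dv subrK.
case/Bezout_eq1_coprimepP=> [[s1 s2] /= bez]; right.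
have [r1 Dr1] := map_poly_surj s1; have [r2 Dr2] := map_poly_surj s2.
have [|v Dv] := @map_poly_eq0_ideal (r1 * h + r2 * q - 1).
  by rewrite rmorphB rmorphD !rmorphM /= Dr1 Dr2 bez rmorph1 subrr.
by exists r2, v, (- r1); rewrite -Dv; ring.
Qed.

End Reduction.

Theorem theorem3p4
  (p a m : nat) (p_prime : prime p) (a_gt0 : (0 < a)%N) (m_gt0 : (0 < m)%N)
  (* GR(p^a, m), its reduction modulo p onto F_{p^m}, and a generator zeta of
     the nonzero Teichmueller elements *)
  (R : finComNzRingType) (R_galois : is_galois_ring p a m R)
  (F : finFieldType) (card_F : #|F| = (p ^ m)%N)
  (red : {rmorphism R -> F}) (red_mod_p : is_reduction_mod p red)
  (zeta : R) (zeta_order : ((p ^ m).-1).-primitive_root zeta)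
  (f h beta : {poly R}) (t : nat)
  (f_monic : f \is monic)
  (f_regular : GRing.lreg f)
  (f_primary : primary_ideal (ideal1 f))
  (f_nonunit : ~ is_unit f)
  (t_gt0 : (0 < t)%N)
  (h_monic : h \is monic)
  (h_basic_irreducible : basic_irreducible red h)
  (h_teichmuller : h \is a polyOver (teichmuller p m zeta))
  (* deg beta < t * deg h, where deg q = (size q).-1 and deg 0 = -oo *)
  (deg_beta : (size beta <= t * (size h).-1)%N)
  (f_def : f = h ^+ t + p%:R * beta) :
  (* as f is monic of size > 1, {poly %/ f} is the quotient of R[x] by f *)
  chain_ring {poly %/ f} <->
  [\/ a = 1%N, t = 1%N | ~ ideal2 (p%:R : {poly R}) h beta].
Proof.
have [char_R _ _] := R_galois; have [red_surj red_eq0] := red_mod_p.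
have [_ irr_h] := h_basic_irreducible.
have polyCp : (p%:R)%:P = p%:R :> {poly R} by rewrite polyC_natr.
have f_gt1 : (1 < size f)%N.
  by rewrite ltnNge; apply/negP => /(monic_size1_is_unit f_monic).
have hbar_gt1 : (1 < size (map_poly red h))%N by case: irr_h.
have h_gt1 : (1 < size h)%N by apply: leq_trans hbar_gt1 (size_poly _ _).
have redp : red p%:R = 0 by apply/red_eq0; exists 1; rewrite mul1r.
have mapp : map_poly red (p%:R : {poly R}) = 0.
  by rewrite -polyCp map_polyC /= redp polyC0.
have pa0 : (p%:R : {poly R}) ^+ a = 0.
  by rewrite -natrX -polyC_natr ((char_R _).2 (dvdnn _)) polyC0.
have dich q : ideal2 (p%:R : {poly R}) h q \/
              exists u, ideal2 (p%:R : {poly R}) h (u * q - 1).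
  by have := reduction_dichotomy red_surj red_eq0 q irr_h; rewrite polyCp.
split=> [chainQ | cond].
  have [t1|t_neq1] := eqVneq t 1%N; first exact: Or32.
  case: ((chain_ring_total_dvd _).1 chainQ (in_qpoly f p%:R) (in_qpoly f h)).
    case/(ideal1_in_qpoly f_monic f_gt1) => u [v Dh].
    case/negP: t_neq1; rewrite eqn_leq t_gt0 andbT.
    rewrite -(dvdp_Pexp2l _ _ hbar_gt1) expr1.
    apply/dvdpP; exists (map_poly red v).
    rewrite -rmorphXn {1}Dh f_def !(rmorphD, rmorphM) /= mapp.
    by rewrite mulr0 mul0r add0r addr0.
  move/(ideal1_in_qpoly f_monic f_gt1); rewrite f_def => p_mod.
  have [a1|a_neq1] := eqVneq a 1%N; first exact: Or31.
  apply: Or33 => beta_in; case/negP: a_neq1.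
  have := dvd_nilpotent_of_dvd_mod pa0 t_gt0 beta_in p_mod; rewrite -polyCp.
  move=> /(polyC_monic_multiple h_monic h_gt1) /char_R.
  by rewrite -[X in (_ %| X)%N]expn1 dvdn_Pexp2l ?prime_gt1 // eqn_leq a_gt0 andbT.
have f_to0 : in_qpoly f f = 0.
  by apply/(in_qpoly_eq0 f_monic f_gt1); exists 1; rewrite mul1r.
apply: (chain_ring_image_nilpotent_pair (@in_qpoly_surj _ f) f_to0 pa0 f_def
          t_gt0 dich).
case: cond => [a1 | t1 | beta_notin]; [apply: Or31 | exact: Or32 | exact: Or33].
by move: pa0; rewrite a1.
Qed.
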